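(* For every integer $\ell\geq2$, the arrangement ${\rm Shi}_\ell$ is not $2$-free.
   Context: $\mathbb{K}$ is a field of characteristic zero. ${\rm Shi}_\ell$ is the central arrangement in $\mathbb{K}^{\ell+1}$ (coordinates $x_1,\dots,x_\ell,z$) with defining polynomial $Q({\rm Shi}_\ell)=z\prod_{i=1}^{\ell}x_i(x_i-z)\prod_{1\leq i<j\leq\ell}(x_i-x_j)(x_i-x_j-z)$. Let $S=\mathbb{K}[x_1,\dots,x_\ell,z]$; regard multiplication by variables and partial derivatives as elements of $\mathrm{End}_{\mathbb{K}}(S)$ (an $S$-module by left multiplication). For a central arrangement $\mathscr{A}$ with defining polynomial $Q$, let $D^{(2)}(S)$ be the free $S$-module with basis all second-order monomials $\partial^{\bm a}$ ($|\bm a|=2$) in the partial derivatives, and $D^{(2)}(\mathscr{A})=\{\theta\in D^{(2)}(S)\mid\theta(QS)\subseteq QS\}$. The arrangement is $2$-free if $D^{(2)}(\mathscr{A})$ is a free $S$-module. *)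

(* Defs.v *)
From HB Require Import structures.
From mathcomp Require Import all_boot all_order all_algebra.
From mathcomp Require Import mpoly.

Set Implicit Arguments.
Unset Strict Implicit.
Unset Printing Implicit Defensive.

Import GRing.Theory.
Local Open Scope ring_scope.

(* A submodule M of V, given by its membership predicate, is free when it has
   a basis, i.e. a possibly infinite subset that generates M and is linearly
   independent. *)
Definition generates (R : nzRingType) (V : lmodType R) (B M : V -> Prop) :=
  forall v, M v -> exists s : seq V, exists c : V -> R,
    (forall b, b \in s -> B b) /\ v = \sum_(b <- s) c b *: b.

Definition lin_independent (R : nzRingType) (V : lmodType R) (B : V -> Prop) :=
  forall (s : seq V) (c : V -> R), uniq s -> (forall b, b \in s -> B b) ->
    \sum_(b <- s) c b *: b = 0 -> forall b, b \in s -> c b = 0.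

Definition free_submodule (R : nzRingType) (V : lmodType R) (M : V -> Prop) :=
  exists B : V -> Prop,
    [/\ forall b, B b -> M b, generates B M & lin_independent B].

Section SecondOrder.
Variables (K : fieldType) (n : nat).
Local Notation S := {mpoly K[n]}.

(* The exponents a of the monomials \partial^a with |a| = 2. *)
Definition exponent2 := {a : 'X_{1..n < 3} | mdeg a == 2%N}.
HB.instance Definition _ := Finite.on exponent2.
Definition expo (a : exponent2) : 'X_{1..n} := val a.

(* D^(2)(S): the free S-module on the second-order monomials.  The regular
   module S^o is needed because {mpoly K[n]} alone is a K-module. *)
Definition D2S : Type := {ffun exponent2 -> S^o}.
HB.instance Definition _ := GRing.Lmodule.on D2S.

(* The element sum_a theta_a \partial^a of D^(2)(S) as an endomorphism of S. *)
Definition d2op (theta : D2S) (f : S) : S :=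
  \sum_(a : exponent2) (theta a : S) * f^`M[expo a].

Fact d2op_is_linear theta : linear (d2op theta).
Proof.
move=> k f g; rewrite /d2op scaler_sumr -big_split /=; apply: eq_bigr => a _.
by rewrite linearP mulrDr scalerAr.
Qed.
HB.instance Definition _ theta :=
  GRing.isLinear.Build K S S _ (d2op theta) (d2op_is_linear theta).

Lemma d2opP (p : S) (theta eta : D2S) f :
  d2op (p *: theta + eta) f = p * d2op theta f + d2op eta f.
Proof.
rewrite /d2op mulr_sumr -big_split /=; apply: eq_bigr => a _.
by rewrite !ffunE mulrDl -mulrA.
Qed.

Lemma d2op_X (theta : D2S) (b : exponent2) :
  d2op theta 'X_[expo b] = theta b *+ \prod_(i < n) (expo b i)`!.
Proof.
rewrite /d2op (bigD1 b) //= big1 => [|a ne_ab]; last first.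
  rewrite mderivmX; case: (boolP (expo a <= expo b)%MM) => [le_ab|].
    have Da : mdeg (expo a) = 2%N := eqP (valP a).
    have Db : mdeg (expo b) = 2%N := eqP (valP b).
    case/eqP: ne_ab; apply/val_inj/val_inj; change (expo a = expo b).
    move: Db; rewrite -(submK le_ab) mdegD Da -[RHS]add0n => /addIn/eqP.
    by rewrite mdeg_eq0 => /eqP ->; rewrite add0m.
  rewrite negb_forall => /existsP[i]; rewrite -ltnNge => lt_ba.
  by rewrite (bigD1 i) //= ffact_small // mul0n scale0r mulr0.
rewrite addr0 mderivmX -[X in (X - _)%MM]add0m addmK mpolyX0 scaler_nat mulrnAr mulr1.
by congr (_ *+ _); apply: eq_bigr => i _; rewrite ffactnn.
Qed.

(* In characteristic zero an element of D^(2)(S) is determined by the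
   endomorphism of S that it induces. *)
Lemma d2op_inj : [pchar K] =i pred0 ->
  forall theta eta : D2S, d2op theta =1 d2op eta -> theta = eta.
Proof.
move=> charK0 theta eta eq_op; apply/ffunP => b; apply/mpolyP => m.
have := eq_op 'X_[expo b]; rewrite !d2op_X; set k := \prod_(_ < _) _.
have k_gt0 : (0 < k)%N by rewrite prodn_gt0 // => i; exact: fact_gt0.
have k_neq0 : k%:R != 0 :> K by rewrite ((pcharf0P K).1 charK0) -lt0n.
move=> /(congr1 (mcoeff m)); rewrite 2!mcoeffMn -[LHS]mulr_natr -[RHS]mulr_natr.
exact: mulIf.
Qed.

(* For a central arrangement in K^n with defining polynomial Q. *)
Definition D2A (Q : S) (theta : D2S) : Prop :=
  forall f : S, exists g : S, d2op theta (Q * f) = Q * g.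

Lemma D2A0 Q : D2A Q 0.
Proof.
by move=> f; exists 0; rewrite /d2op mulr0 big1 // => a _; rewrite ffunE mul0r.
Qed.

Lemma D2AP Q (p : S) theta eta :
  D2A Q theta -> D2A Q eta -> D2A Q (p *: theta + eta).
Proof.
move=> Dt De f; have [g tg] := Dt f; have [h eh] := De f.
by exists (p * g + h); rewrite d2opP tg eh mulrDr mulrCA.
Qed.

Definition two_free (Q : S) : Prop := free_submodule (D2A Q).

End SecondOrder.

(* Q(Shi_l); the coordinates 0, ..., l-1 are x_1, ..., x_l, the last is z. *)
Definition ShiQ (K : fieldType) (l : nat) : {mpoly K[l.+1]} :=
  let x (i : 'I_l) : {mpoly K[l.+1]} := 'X_(widen_ord (leqnSn l) i) in
  let z : {mpoly K[l.+1]} := 'X_ord_max in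
  z * (\prod_(i < l) (x i * (x i - z)))
    * \prod_(i < l) \prod_(j < l | (i < j)%N) ((x i - x j) * (x i - x j - z)).

(* Main.v *)
Require Import Defs.
From mathcomp Require Import all_boot all_order all_algebra.
From mathcomp Require Import mpoly ring zify.

(* Write x, y for x_1, x_2, and Q(Shi_l) = q R where q collects the seven
   factors vanishing on x = y = z = 0, i.e. those of Shi_2.  An operator
   theta = sum B_ij d_i d_j with B symmetric lies in D^(2) iff every row of B
   is a derivation tangent to each hyperplane.  If D^(2) is free, then z is
   a nonzerodivisor on D^(2)/(x, y)D^(2).
   There are 3 x 3 matrices T_x, T_y, T_z with rows tangent to Shi_2 such that
   T_k - T_k^t = k eta for one fixed eta of degree 2.  Then x T_y - y T_x and
   its analogues are symmetric, so R times them lies in D^(2), and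
   z (x T_y - y T_x) = x (z T_y - y T_z) + y (x T_z - z T_x).  Freeness
   gives R (x T_y - y T_x) = x theta + y theta' with theta, theta' in D^(2),
   so that (R T_x + theta') / x = (R T_y - theta) / y is a matrix with tangent
   rows whose antisymmetrization is R eta.  At a generic point of x = y = z = 0
   the quadratic part of such a matrix contradicts the fact that up to degree 2
   only multiples of the Euler derivation are tangent to Shi_2. *)

Set Implicit Arguments.
Unset Strict Implicit.
Unset Printing Implicit Defensive.

Import GRing.Theory.

(** * Free submodules and regular triples of scalars *)

Section FreeModules.
Local Open Scope ring_scope.
Variables (R : comNzRingType) (V : lmodType R).
Implicit Types (M : V -> Prop) (s : seq V).

Lemma seq_choice (I : eqType) (T : Type) (x0 : T) (P : I -> T -> Prop)
    (s : seq I) :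
  (forall i, i \in s -> exists x, P i x) ->
  exists f, forall i, i \in s -> P i (f i).
Proof.
elim: s => [|i s IHs] Ps; first by exists (fun=> x0).
have [j js|f Pf] := IHs; first by apply: Ps; rewrite inE js orbT.
have [x Px] := Ps i (mem_head _ _).
exists (fun j => if j == i then x else f j) => j; rewrite inE.
by case: (eqVneq j i) => [->|_] //= /Pf.
Qed.

(** Expansions in [generates] may repeat vectors, while [lin_independent] speaks of lists without
    repetition; multiplicities are absorbed into the coefficients. *)
Lemma sum_uniq_support (F : V -> V) s1 s : uniq s -> {subset s1 <= s} ->
  \sum_(b <- s1) F b = \sum_(b <- s) F b *+ count_mem b s1.
Proof.
move=> Us; elim: s1 => [|x s1 IHs] sub; first by rewrite big_nil big1.
have xs : x \in s by apply: sub; rewrite mem_head.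
rewrite big_cons IHs => [|y ys]; last by apply: sub; rewrite inE ys orbT.
under [RHS]eq_bigr => b _ do rewrite /= mulrnDr.
rewrite big_split /=; congr (_ + _).
rewrite (bigD1_seq x) //= eqxx mulr1n big1 ?addr0 // => b /negbTE.
by rewrite eq_sym => ->.
Qed.

Lemma submodule_sum M (c : V -> R) s :
  M 0 -> (forall a u v, M u -> M v -> M (a *: u + v)) ->
  (forall b, b \in s -> M b) -> M (\sum_(b <- s) c b *: b).
Proof.
move=> M0 ML; elim: s => [|b s IHs] Ms; first by rewrite big_nil.
rewrite big_cons; apply: ML; first exact/Ms/mem_head.
by apply: IHs => d ds; apply: Ms; rewrite inE ds orbT.
Qed.

Lemma generates_uniq (B M : V -> Prop) s1 v : generates B M -> M v ->
  exists s, (forall b, b \in s -> B b) /\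
    forall s', uniq s' -> {subset s <= s'} ->
      exists c : V -> R, v = \sum_(b <- s') c b *: b.
Proof.
move=> gen /gen[s [c [Bs ->]]]; exists s; split=> // s' Us' sub.
exists (fun b => c b *+ count_mem b s); rewrite (sum_uniq_support _ Us' sub).
by apply: eq_bigr => b _; rewrite scalerMnl.
Qed.

(** The three elements are expanded over one finite list of basis vectors. Independence splits the
    relation into relations between coefficients, where the hypothesis on [R] applies. *)
Lemma free_submodule_regular M (a b c : R) : free_submodule M ->
  M 0 -> (forall a u v, M u -> M v -> M (a *: u + v)) ->
  (forall h f g, c * h = a * f + b * g ->
     exists f' g', h = a * f' + b * g') ->
  forall u v w, M u -> M v -> M w -> c *: w = a *: u + b *: v ->
    exists u' v', [/\ M u', M v' & w = a *: u' + b *: v'].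
Proof.
case=> B [BM gen indep] M0 ML reg u v w Mu Mv Mw eq_w.
have [su [Bu ex_u]] := generates_uniq [::] gen Mu.
have [sv [Bv ex_v]] := generates_uniq [::] gen Mv.
have [sw [Bw ex_w]] := generates_uniq [::] gen Mw.
pose s := undup (su ++ sv ++ sw).
have Us : uniq s by exact: undup_uniq.
have Bs d : d \in s -> B d.
  by rewrite mem_undup !mem_cat => /or3P[/Bu|/Bv|/Bw].
have [|cu def_u] := ex_u s Us.
  by move=> d ds; rewrite mem_undup !mem_cat ds.
have [|cv def_v] := ex_v s Us.
  by move=> d ds; rewrite mem_undup !mem_cat ds orbT.
have [|cw def_w] := ex_w s Us.
  by move=> d ds; rewrite mem_undup !mem_cat ds !orbT.
have rel d : d \in s -> c * cw d - (a * cu d + b * cv d) = 0.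
  apply: (indep _ (fun d => c * cw d - (a * cu d + b * cv d))) => //.
  transitivity (c *: w - (a *: u + b *: v)); last by rewrite eq_w subrr.
  rewrite def_u def_v def_w !scaler_sumr -big_split -sumrB /=.
  by apply: eq_bigr => e _; rewrite scalerBl scalerDl !scalerA.
have [d ds|f def_f] := @seq_choice _ _ (0, 0)
    (fun d (p : R * R) => cw d = a * p.1 + b * p.2) s.
  by have /eqP := rel d ds; rewrite subr_eq0 => /eqP/reg[p [q ->]]; exists (p, q).
exists (\sum_(d <- s) (f d).1 *: d), (\sum_(d <- s) (f d).2 *: d).
split; try by apply: submodule_sum => // d /Bs/BM.
rewrite def_w !scaler_sumr -big_split /=; apply: eq_big_seq => d ds.
by rewrite (def_f d ds) scalerDl !scalerA.
Qed.

End FreeModules.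

(** * Divisibility, and cancellation modulo an element *)

Section Divisibility.
Local Open Scope ring_scope.
Variable R : comNzRingType.
Implicit Types a b f g h : R.

Definition dv a f := exists g, f = a * g.
(** This says that multiplication by [b] is injective modulo [a]. *)
Definition coprime_to a b := forall f, dv a (b * f) -> dv a f.

Lemma dvD a f g : dv a f -> dv a g -> dv a (f + g).
Proof. by case=> f' -> [g' ->]; exists (f' + g'); rewrite mulrDr. Qed.

Lemma dvMl a f g : dv a f -> dv a (g * f).
Proof. by case=> f' ->; exists (g * f'); rewrite mulrCA. Qed.

Lemma dvN a f : dv a f -> dv a (- f).
Proof. by case=> f' ->; exists (- f'); rewrite mulrN. Qed.

Lemma dvv a : dv a a. Proof. by exists 1; rewrite mulr1. Qed.

Lemma dv0 a : dv a 0. Proof. by exists 0; rewrite mulr0. Qed.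

Lemma coprime_toM a b c :
  coprime_to a b -> coprime_to a c -> coprime_to a (b * c).
Proof. by move=> ab ac f; rewrite -mulrA => /ab/ac. Qed.

Lemma coprime_to_prod (I : eqType) (s : seq I) (F : I -> R) a :
  (forall i, i \in s -> coprime_to a (F i)) ->
  coprime_to a (\prod_(i <- s) F i).
Proof.
elim: s => [|i s IHs] cop; first by move=> f; rewrite big_nil mul1r.
rewrite big_cons; apply: coprime_toM; first exact/cop/mem_head.
by apply: IHs => j js; apply: cop; rewrite inE js orbT.
Qed.

End Divisibility.

(** * Substitutions in polynomial rings *)

Section Polynomials.
Local Open Scope ring_scope.
Variables (K : fieldType) (n : nat).
Local Notation S := {mpoly K[n]}.
Implicit Types (f g h a : S).

Lemma mpoly_algebra_ind (P : S -> Prop) :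
    (forall c : K, P c%:MP) -> (forall i, P 'X_i) ->
    (forall f g, P f -> P g -> P (f + g)) ->
    (forall f g, P f -> P g -> P (f * g)) ->
  forall f, P f.
Proof.
move=> PC PX PD PM f; elim/mpolyind: f => [|c m f _ _ Pf].
  by rewrite -mpolyC0; apply: PC.
apply: PD => //; rewrite -mul_mpolyC; apply: (PM); first exact: PC.
rewrite mpolyXE_id; apply: big_ind => [||i _].
- by rewrite -mpolyC1; apply: PC.
- exact: PM.
 elim: (m i) => [|k IHk]; first by rewrite expr0 -mpolyC1; apply: PC.
by rewrite exprS; apply: PM.
Qed.

Lemma mpolyXU_neq0 (i : 'I_n) : 'X_i != 0 :> S.
Proof.
apply/eqP => /(congr1 (meval (fun=> 1))); rewrite mevalXU meval0 => /eqP.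
by rewrite oner_eq0.
Qed.

(** [J] plays the role of an ideal: a substitution that is the identity modulo [J] on the variables
    is so on all polynomials. *)
Lemma comp_mpoly_congr (J : S -> Prop) (q : n.-tuple S) :
    J 0 -> (forall f g, J f -> J g -> J (f + g)) ->
    (forall f g, J f -> J (g * f)) ->
    (forall i, J ('X_i - tnth q i)) ->
  forall f, J (f - (f \mPo q)).
Proof.
move=> J0 JD JM JX; apply: mpoly_algebra_ind => [c|i|f g Jf Jg|f g Jf Jg].
- by rewrite comp_mpolyC subrr.
- by rewrite comp_mpolyXU -tnth_nth.
- by rewrite comp_mpolyD opprD addrACA; apply: JD.
rewrite rmorphM /=.
have -> : f * g - (f \mPo q) * (g \mPo q) =
   f * (g - (g \mPo q)) + (g \mPo q) * (f - (f \mPo q)) by ring.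
by apply: JD; apply: JM.
Qed.

(* Substituting 'X_i - a for 'X_i kills a, and is the identity modulo a. *)
Lemma linear_coprime (i : 'I_n) a b (p : 'I_n -> K) :
    a \mPo [tuple if j == i then 'X_i - a else 'X_j | j < n] = 0 ->
    a.@[p] = 0 -> b.@[p] != 0 ->
  coprime_to a b.
Proof.
set q := [tuple _ | _ < n] => a0 ap bp f [g].
have red h : dv a (h - (h \mPo q)).
  apply: comp_mpoly_congr => [|||j]; first exact: dv0.
  - exact: dvD.
  - by move=> ? ?; apply: dvMl.
  rewrite tnth_mktuple; case: eqVneq => [->|_]; last first.
    by rewrite subrr; apply: dv0.
  by rewrite subKr; apply: dvv.
move=> /(congr1 (comp_mpoly q)); rewrite !rmorphM /= a0 mul0r.
(* If the image of [b] were zero, [a] would divide [b], against the values at [p]. *)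
move/eqP; rewrite mulf_eq0 => /orP[/eqP b0|/eqP f0]; last first.
  by have := red f; rewrite f0 subr0.
have [h] := red b; rewrite b0 subr0 => def_b; move: bp.
by rewrite def_b mevalM ap mul0r eqxx.
Qed.

(** Setting ['X_i] and ['X_j] to zero is the identity modulo the ideal they generate, kills the
    right-hand side and keeps ['X_k]; hence it kills [h]. *)
Lemma variables_regular (i j k : 'I_n) : k != i -> k != j ->
  forall h f g, 'X_k * h = 'X_i * f + 'X_j * g ->
    exists f' g' : S, h = 'X_i * f' + 'X_j * g'.
Proof.
move=> ki kj h f g.
pose q := [tuple if (m == i) || (m == j) then 0 else 'X_m : S | m < n].
have [] : exists f' g' : S, h - (h \mPo q) = 'X_i * f' + 'X_j * g'.
  apply: (@comp_mpoly_congr (fun u => exists f' g', u = 'X_i * f' + 'X_j * g')).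
  - by exists 0, 0; rewrite !mulr0 addr0.
  - by move=> _ _ [a [b ->]] [c [d ->]]; exists (a + c), (b + d); ring.
  - by move=> _ e [a [b ->]]; exists (e * a), (e * b); ring.
  move=> m; rewrite tnth_mktuple.
  have [->|mi] := eqVneq m i.
    by exists 1, 0; rewrite /= mulr1 mulr0 subr0 addr0.
  have [->|mj] := eqVneq m j.
    by exists 0, 1; rewrite /= mulr1 mulr0 subr0 add0r.
  by exists 0, 0; rewrite /= !mulr0 subrr addr0.
move=> f' [g' def_h] /(congr1 (comp_mpoly q)).
rewrite rmorphD !rmorphM /= !comp_mpolyXU -!tnth_nth !tnth_mktuple !eqxx orbT /=.
rewrite (negbTE ki) (negbTE kj) !mul0r addr0 => /eqP; rewrite mulf_eq0.
rewrite (negbTE (mpolyXU_neq0 k)) /= => /eqP h0; exists f', g'.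
by rewrite -def_h h0 subr0.
Qed.

End Polynomials.

(** * Second-order operators and tangency to one hyperplane *)

Section SecondOrderOperators.
Local Open Scope ring_scope.
Variables (K : fieldType) (n : nat).
Local Notation S := {mpoly K[n]}.
Implicit Types (f g h a b : S) (theta : D2S K n).

Lemma d2op0 f : d2op (0 : D2S K n) f = 0.
Proof. by rewrite /d2op big1 // => e _; rewrite ffunE mul0r. Qed.

Lemma d2opD theta eta f : d2op (theta + eta) f = d2op theta f + d2op eta f.
Proof. by rewrite -[theta]scale1r d2opP mul1r scale1r. Qed.

Lemma d2opZ p theta f : d2op (p *: theta) f = p * d2op theta f.
Proof. by rewrite -[p *: theta]addr0 d2opP d2op0 addr0. Qed.

Lemma d2op_sum (I : Type) (r : seq I) (F : I -> D2S K n) f :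
  d2op (\sum_(i <- r) F i) f = \sum_(i <- r) d2op (F i) f.
Proof.
by elim: r => [|i r IHr]; rewrite ?big_nil ?d2op0 // !big_cons d2opD IHr.
Qed.

Definition affine f := forall i j, f^`M(i)^`M(j) = 0.

Lemma expo2P (e : exponent2 n) : exists i j, expo e = (U_(i) + U_(j))%MM.
Proof.
have De : mdeg (expo e) = 2%N := eqP (valP e).
have [i ei] : exists i, expo e i != 0%N.
  apply/existsP; rewrite -negb_forall; apply/negP => /forallP e0.
  by move: De; rewrite mdegE big1 // => i _; apply/eqP/e0.
have le_ie : (U_(i) <= expo e)%MM.
  by apply/mnm_lepP => j; rewrite mnm1E; case: eqP => // <-; rewrite lt0n.
have /mdeg1P[j /eqP ej] : mdeg (expo e - U_(i))%MM == 1%N.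
  by move: De; rewrite -{1}(submK le_ie) mdegD mdeg1 addn1 => -[->].
by exists j, i; rewrite -ej submK.
Qed.

Lemma mderivm2 i j f : f^`M[U_(i) + U_(j)] = f^`M(i)^`M(j).
Proof. by rewrite mderivmDm !mderivmU1m. Qed.

Lemma d2op_affine theta f : affine f -> d2op theta f = 0.
Proof.
move=> f0; rewrite /d2op big1 // => e _.
by have [i [j ->]] := expo2P e; rewrite mderivm2 f0 mulr0.
Qed.

Lemma affineC (c : K) : affine c%:MP.
Proof. by move=> i j; rewrite mderivC mderiv0. Qed.

Lemma mderivXU (i j : 'I_n) : ('X_j)^`M(i) = ((i == j)%:R)%:MP :> S.
Proof.
rewrite mderivX mnm1E eq_sym; case: eqP => [->|_]; last first.
  by rewrite scale0r mpolyC0.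
by rewrite -[X in (X - _)%MM]add0m addmK mpolyX0 scale1r.
Qed.

Lemma affineX i : affine 'X_i.
Proof. by move=> j k; rewrite mderivXU mderivC. Qed.

Lemma affineD f g : affine f -> affine g -> affine (f + g).
Proof. by move=> f0 g0 i j; rewrite !mderivD f0 g0 addr0. Qed.

Lemma affineZ c f : affine f -> affine (c *: f).
Proof. by move=> f0 i j; rewrite !mderivZ f0 scaler0. Qed.

(** The third iterated commutator of a second-order operator with multiplications vanishes; the term
    in [d2op theta 1] is absent because [theta] has only terms of order two. *)
Lemma d2opM3 theta f g h : d2op theta (f * g * h) =
  f * d2op theta (g * h) + g * d2op theta (f * h) + h * d2op theta (f * g)
  - f * g * d2op theta h - f * h * d2op theta g - g * h * d2op theta f.
Proof.
rewrite /d2op !mulr_sumr -!big_split -!sumrB /=; apply: eq_bigr => e _.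
have [i [j ->]] := expo2P e; rewrite !mderivm2 !(mderivM, mderivD) /=.
by move: (theta e) => t; ring.
Qed.

Lemma affine_mderivM f g i j : affine f -> affine g ->
  (f * g)^`M(i)^`M(j) = f^`M(i) * g^`M(j) + f^`M(j) * g^`M(i).
Proof.
move=> f0 g0; rewrite mderivM mderivD !mderivM f0 g0.
by rewrite mul0r mulr0 add0r addr0.
Qed.

(** By [d2opM3] with [d2op theta a = 0], the set of good [f] is closed under products, so testing
    the variables suffices. *)
Lemma d2op_dv theta a : affine a ->
  (forall i, dv a (d2op theta (a * 'X_i))) -> D2A a theta.
Proof.
move=> a0 aX; rewrite /D2A -[forall f, _]/(forall f, dv a (d2op theta (a * f))).
apply: mpoly_algebra_ind => [c|//|f g af ag|f g af ag].
- by rewrite mulrC mul_mpolyC linearZ /= d2op_affine // scaler0; apply: dv0.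
- by rewrite mulrDr linearD; apply: dvD.
rewrite mulrA d2opM3 (d2op_affine _ a0) mulr0 subr0.
have [[f' ->] [g' ->]] := (af, ag).
exists (d2op theta (f * g) + f * g' + g * f' - f * d2op theta g
  - g * d2op theta f).
by ring.
Qed.

(** Expanding [d2op theta (a * b * 'X_i)] by [d2opM3], every term other than
    [b * d2op theta (a * 'X_i)] is a multiple of [a]; then [b] is cancelled. *)
Lemma D2A_dvX theta a b : affine a -> coprime_to a b -> D2A (a * b) theta ->
  forall i, dv a (d2op theta (a * 'X_i)).
Proof.
move=> a0 ab Dab i; apply: ab.
have [[g def_g] [g' def_g']] := (Dab 'X_i, Dab 1).
rewrite d2opM3 (d2op_affine _ a0) (d2op_affine _ (affineX i)) in def_g.
rewrite mulr1 in def_g'.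
exists (b * g - d2op theta (b * 'X_i) - 'X_i * b * g' + 'X_i * d2op theta b).
rewrite def_g' in def_g; rewrite !(mulrDr a) [a * (b * g)]mulrA -def_g.
by ring.
Qed.

Lemma D2A_M theta a b : coprime_to a b ->
  D2A a theta -> D2A b theta -> D2A (a * b) theta.
Proof.
move=> ab Da Db f; have [g ag] := Da (b * f); have [h bh] := Db (a * f).
have [|k def_h] := ab h; first by exists g; rewrite -ag -bh mulrCA.
by exists k; rewrite -mulrA mulrCA bh def_h; ring.
Qed.

Lemma D2A_1 theta : D2A 1 theta.
Proof. by move=> f; exists (d2op theta (1 * f)); rewrite !mul1r. Qed.

Lemma D2A_prod theta (I : eqType) (s : seq I) (F : I -> S) : uniq s ->
  {in s &, forall i j, i != j -> coprime_to (F i) (F j)} ->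
  (forall i, i \in s -> D2A (F i) theta) -> D2A (\prod_(i <- s) F i) theta.
Proof.
elim: s => [|i s IHs] /=; first by rewrite big_nil => *; apply: D2A_1.
case/andP=> i_s Us cop Ds; rewrite big_cons; apply: D2A_M.
- apply: coprime_to_prod => j js; apply: cop; rewrite ?mem_head ?inE ?js ?orbT //.
  by apply: contraNneq i_s => ->.
- exact/Ds/mem_head.
apply: IHs => // [j k js ks|j js]; last by apply: Ds; rewrite inE js orbT.
by apply: cop; rewrite inE ?js ?ks orbT.
Qed.

Lemma D2A_cofactor theta a b : D2A a theta -> D2A (a * b) (b *: theta).
Proof.
move=> Da f; have [g ag] := Da (b * f); exists g.
by rewrite d2opZ -mulrA ag mulrCA mulrA.
Qed.

Definition d2mono (i j : 'I_n) : D2S K n :=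
  [ffun e => ((expo e == U_(i) + U_(j))%MM)%:R].

Lemma d2op_mono i j f : d2op (d2mono i j) f = f^`M(i)^`M(j).
Proof.
have lt3 : (mdeg (U_(i) + U_(j))%MM < 3)%N by rewrite mdegD !mdeg1.
have deg2 : mdeg (bmnm (BMultinom lt3)) == 2%N by rewrite /= mdegD !mdeg1.
pose e0 : exponent2 n := exist _ (BMultinom lt3) deg2.
rewrite /d2op (bigD1 e0) //= ffunE eqxx mul1r mderivm2 big1 ?addr0 // => e ne.
rewrite ffunE; case: eqP => [eq_e|_]; last by rewrite mul0r.
by case/eqP: ne; apply/val_inj/val_inj.
Qed.

End SecondOrderOperators.

(** * The seven forms of Shi_2 and the factorization of Q *)

Section Lines.
Local Open Scope ring_scope.
Variables (K : fieldType) (m : nat).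
Hypothesis charK0 : [pchar K] =i pred0.
Local Notation S := {mpoly K[m.+3]}.

(** Positions of x_1, x_2 and z among all coordinates; every index above 1 stands for z. *)
Definition var (k : nat) : 'I_m.+3 :=
  match k with 0 => ord0 | 1 => Ordinal (isT : (1 < m.+3)%N) | _ => ord_max end.

Lemma var_inj (i j : 'I_3) : (var i == var j) = (i == j).
Proof.
by case: i j => [[|[|[|//]]] ?] [[|[|[|//]]] ?] //=; rewrite !eqxx.
Qed.

Definition lform (a : seq int) : S := \sum_(k < 3) (a`_k)%:~R * 'X_(var k).

Definition shi2 : seq (seq int) :=
  [:: [:: 0; 0; 1]; [:: 1; 0; 0]; [:: 1; 0; -1]; [:: 0; 1; 0]; [:: 0; 1; -1];
      [:: 1; -1; 0]; [:: 1; -1; -1]].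

Lemma intr_mpolyC (c : int) : c%:~R = (c%:~R)%:MP :> S.
Proof. by rewrite -[LHS](rmorph_int (@mpolyC m.+3 K)). Qed.

Lemma mderiv_lform a (k : 'I_3) : (lform a)^`M(var k) = (a`_k)%:~R.
Proof.
rewrite /lform linear_sum (bigD1 k) //= big1 ?addr0 => [|j jk].
  by rewrite intr_mpolyC mderiv_mulC mderivXU eqxx mulr1.
by rewrite intr_mpolyC mderiv_mulC mderivXU var_inj eq_sym (negbTE jk) mulr0.
Qed.

Lemma affine_lform a : affine (lform a).
Proof.
rewrite /lform; elim/big_ind: _ => [|f g|k _].
- by rewrite -mpolyC0; apply: affineC.
- exact: affineD.
by rewrite intr_mpolyC mul_mpolyC; apply/affineZ/affineX.
Qed.

Lemma intr_neq0 (c : int) : c != 0 -> c%:~R != 0 :> K.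
Proof.
have nat_neq0 k : (k.+1%:R != 0 :> K) by rewrite ((pcharf0P K).1 charK0).
case: c => [[|k]|k] //= _; first exact: nat_neq0.
by rewrite NegzE mulrNz oppr_eq0 nat_neq0.
Qed.

(* Off the first two and the last, the coordinates are so large that the point
   avoids all hyperplanes other than those of Shi_2. *)
Definition coord (p : seq nat) (i : nat) : nat :=
  if i == 0%N then nth 0%N p 0 else if i == 1%N then nth 0%N p 1
  else if i == m.+2 then nth 0%N p 2 else (10 * i)%N.

Definition point (p : seq nat) (i : 'I_m.+3) : K := (coord p i)%:R.

Lemma coord_var p (k : 'I_3) : coord p (var k) = nth 0%N p k.
Proof. by case: k => [[|[|[|//]]] ?]; rewrite /coord //= eqxx. Qed.

Definition dot (a : seq int) (p : seq nat) : int :=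
  a`_0 * Posz (nth 0%N p 0) + a`_1 * Posz (nth 0%N p 1) +
  a`_2 * Posz (nth 0%N p 2).

Lemma meval_lform a p : (lform a).@[point p] = (dot a p)%:~R.
Proof.
rewrite /lform !big_ord_recl big_ord0 addr0 !mevalD !mevalM !intr_mpolyC.
rewrite !mevalC !mevalXU /point !coord_var /dot /= !rmorphD !rmorphM /=.
by rewrite addrA.
Qed.

(** In the order of [shi2], each point lies on the corresponding hyperplane of Shi_2 and on no other
    one. *)
Definition test_points : seq (seq nat) :=
  [:: [:: 1; 3; 0]; [:: 0; 3; 1]; [:: 1; 3; 1]; [:: 3; 0; 1]; [:: 3; 1; 1];
      [:: 3; 3; 1]; [:: 4; 3; 1]]%N.

Lemma shi2_points a : a \in shi2 ->
  exists2 p, p \in test_points &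
    dot a p = 0 /\ forall b, b \in shi2 -> b != a -> dot b p != 0.
Proof.
have : all (fun a => has (fun p => (dot a p == 0) &&
   all (fun b => (b == a) || (dot b p != 0)) shi2) test_points) shi2.
  by vm_compute.
move=> /allP all_a /all_a /hasP[p p_pts /andP[/eqP ap0 /allP all_b]].
exists p => //; split=> // b /all_b; by case: eqP.
Qed.

(** Every form of [shi2] has a coefficient 1, so that [linear_coprime] can eliminate the variable
    carrying it. *)
Lemma lform_coprime a b p : a \in shi2 -> dot a p = 0 -> b.@[point p] != 0 ->
  coprime_to (lform a) b.
Proof.
move=> a_shi ap bp.
have [k ak] : exists k : 'I_3, a`_k = 1.
  have : all (fun a : seq int => has (fun k => a`_k == 1) (iota 0 3)) shi2 by [].
  move=> /allP/(_ a a_shi)/hasP[k]; rewrite mem_iota => /= lt_k3 /eqP ak.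
  by exists (Ordinal lt_k3).
apply: (linear_coprime (i := var k)) bp; last first.
  by rewrite meval_lform ap.
rewrite {1}/lform rmorph_sum /=.
under eq_bigr => j _.
  rewrite rmorphM /= comp_mpolyXU -tnth_nth tnth_mktuple var_inj.
  rewrite intr_mpolyC comp_mpolyC -intr_mpolyC.
  have -> : (if j == k then 'X_(var k) - lform a else 'X_(var j)) =
            'X_(var j) - (j == k)%:R * lform a.
    by case: eqP => [->|_]; rewrite ?mul1r // mul0r subr0.
  rewrite mulrBr mulrA.
  over.
rewrite sumrB -/(lform a) (bigD1 k) //= ak eqxx !mul1r big1 ?addr0 ?subrr //.
by move=> j /negbTE->; rewrite mulr0 mul0r.
Qed.

Lemma lform_coprime2 a b : a \in shi2 -> b \in shi2 -> b != a ->
  coprime_to (lform a) (lform b).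
Proof.
move=> a_shi b_shi ba; have [p _ [ap bp]] := shi2_points a_shi.
apply: (lform_coprime a_shi ap); rewrite meval_lform.
exact/intr_neq0/bp.
Qed.

Lemma natrB_neq0 (a b : nat) : (a < b)%N -> a%:R - b%:R != 0 :> K.
Proof.
move=> lt_ab; have : (a%:Z - b%:Z)%:~R != 0 :> K by apply: intr_neq0; lia.
by rewrite rmorphB.
Qed.

Lemma ShiQ_factor : exists R : S,
  ShiQ K m.+2 = (\prod_(a <- shi2) lform a) * R /\
  forall a b c : nat, (a < 10)%N -> (b < 10)%N -> (c < 2)%N ->
    R.@[point [:: a; b; c]] != 0.
Proof.
have lformE a : lform a =
    (a`_0)%:~R * 'X_ord0 + ((a`_1)%:~R * 'X_(var 1) + (a`_2)%:~R * 'X_ord_max).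
  by rewrite /lform !big_ord_recl big_ord0 addr0.
pose x (i : 'I_m.+2) : S := 'X_(widen_ord (leqnSn m.+2) i).
have -> : ShiQ K m.+2 =
    'X_ord_max * (\prod_(i < m.+2) (x i * (x i - 'X_ord_max))) *
    \prod_(i < m.+2) \prod_(j < m.+2 | (i < j)%N)
      ((x i - x j) * (x i - x j - 'X_ord_max)) by [].
pose i1 : 'I_m.+2 := Ordinal (isT : (1 < m.+2)%N).
have x0 : x ord0 = 'X_ord0 by congr 'X_ _; apply: val_inj.
have x1 : x i1 = 'X_(var 1) by congr 'X_ _; apply: val_inj.
rewrite (bigD1 ord0) //= (bigD1 i1) //= x0 x1.
rewrite [\prod_(i < m.+2) \prod_(j < _ | _) _](bigD1 ord0) //=.
rewrite [\prod_(j < m.+2 | (_ < j)%N) _](bigD1 i1) //= x0 x1.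
(* Here [P1] collects the x_i (x_i - z) with i > 2, [P2] the pairs of x_1 with some x_j, j > 2, and
   [P3] the pairs without x_1. *)
set P1 := \prod_(i | _) _; set P2 := \prod_(i | _) _; set P3 := \prod_(i | _) _.
exists (P1 * P2 * P3); split.
  by rewrite /shi2 !big_cons big_nil !lformE /=; ring.
move=> a b c a10 b10 c2; set p := [:: a; b; c].
have xp i : (x i).@[point p] = (coord p i)%:R by rewrite mevalXU.
have zp : ('X_ord_max : S).@[point p] = c%:R.
  by rewrite mevalXU /point (coord_var p (Ordinal (isT : (2 < 3)%N))).
have big_x (i : 'I_m.+2) : (1 < i)%N -> coord p i = (10 * i)%N.
  by rewrite /coord; have := ltn_ord i; case: (i : nat) => [|[|k]] //= lt_k _;
    rewrite ltn_eqF.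
have small_x (i j : 'I_m.+2) : (1 < j)%N -> (i < j)%N ->
    (coord p i < coord p j)%N.
  move=> j1 ij; rewrite (big_x j) //; case: (ltnP 1 i) => i1'.
    by rewrite big_x //; lia.
  by rewrite /coord /=; case: (i : nat) i1' => [|[|k]] //= _; lia.
have diff_x (i j : 'I_m.+2) : (1 < j)%N -> (i < j)%N ->
    ((x i - x j) * (x i - x j - 'X_ord_max)).@[point p] != 0.
  move=> j1 ij; rewrite mevalM !mevalB zp !xp mulf_neq0 //.
    exact/natrB_neq0/small_x.
  by rewrite -addrA -opprD -natrD natrB_neq0 // ltn_addr // small_x.
rewrite !mevalM !mulf_neq0 //.
- rewrite rmorph_prod; apply/prodf_neq0 => i /andP[i0 i1'].
  have i2 : (1 < i)%N by move: i0 i1'; rewrite -!val_eqE /=; lia.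
  rewrite /= mevalM mevalB zp !xp big_x // mulf_neq0 //.
    by rewrite ((pcharf0P K).1 charK0); lia.
  by rewrite -oppr_eq0 opprB natrB_neq0 //; lia.
- rewrite rmorph_prod; apply/prodf_neq0 => j /andP[j0 j1'].
  by rewrite -x0; apply: diff_x => //; move: j0 j1'; rewrite -!val_eqE /=; lia.
rewrite rmorph_prod; apply/prodf_neq0 => i i0.
rewrite rmorph_prod; apply/prodf_neq0 => j ij.
by apply: diff_x => //; move: i0 ij; rewrite -!val_eqE /=; lia.
Qed.

End Lines.

(** * The matrices T_x, T_y, T_z *)

Section Tensors.
Local Open Scope ring_scope.
Variables (R : comNzRingType) (x y z : R).

(* [xyz] (the Euler derivation), [der2] and [der3] form a basis of the
   derivations tangent to Shi_2; the coefficients of [tensor] in this basis were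
   found by linear algebra so as to satisfy [tensor_skew]. *)
Definition xyz : seq R := [:: x; y; z].
Definition der2 : seq R := [:: x * (x - z) * (y *+ 2 - x); y * (y - z) * x; 0].
Definition der3 : seq R :=
  [:: x * (x - z) * (x - y - z); y * (y - z) * (x - y - z); 0].

Definition coef1 : seq (seq R) :=
  [:: [:: x * y *+ 2 - x ^+ 2; x * z + x * y - x ^+ 2; x * y *+ 2 - x ^+ 2];
      [:: x * y - x * z + x ^+ 2; x * y; x * y];
      [:: 0; z ^+ 2 - y ^+ 2 - x * z + x * y; 0]].
Definition coef2 : seq (seq R) :=
  [:: [:: - 2; -1; -1]; [:: -1; 0; -1]; [:: -1; -1; 0]].
Definition coef3 : seq (seq R) :=
  [:: [:: 0; 0; 0]; [:: 0; 0; -1]; [:: 0; -1; 0]].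

Definition tensor (k i j : nat) : R :=
  (nth [::] coef1 k)`_i * xyz`_j + (nth [::] coef2 k)`_i * der2`_j
  + (nth [::] coef3 k)`_i * der3`_j.

Definition skew (i j : nat) : R :=
  ((i == 1%N) && (j == 2%N))%:R * ((y - z) * (x - y - z))
  - ((i == 2%N) && (j == 1%N))%:R * ((y - z) * (x - y - z)).

Lemma tensor_skew (k i j : 'I_3) :
  tensor k i j - tensor k j i = xyz`_k * skew i j.
Proof.
by case: k i j => [[|[|[|//]]] ?] [[|[|[|//]]] ?] [[|[|[|//]]] ?];
  rewrite /tensor /skew /=; ring.
Qed.

(** Each row is a combination of three derivations. The Euler derivation maps a linear form to
    itself; for the other two the quotients are given form by form. *)
Lemma tensor_row (a : seq int) (k i : 'I_3) : a \in shi2 ->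
  dv (\sum_(j < 3) (a`_j)%:~R * xyz`_j)
     (\sum_(j < 3) (a`_j)%:~R * tensor k i j).
Proof.
move=> a_shi; set f := \sum_(j < 3) _ * xyz`_ _.
have dv1 : dv f f by exact: dvv.
have f_xyz : f = \sum_(j < 3) (a`_j)%:~R * xyz`_j by [].
have dv2 : dv f (\sum_(j < 3) (a`_j)%:~R * der2`_j).
  rewrite f_xyz !big_ord_recl !big_ord0 /=; move: a_shi; rewrite !inE.
  case/or4P=> [|||/or4P[]] /eqP-> /=.
  - by exists 0; ring.
  - by exists ((x - z) * (y *+ 2 - x)); ring.
  - by exists (x * (y *+ 2 - x)); ring.
  - by exists ((y - z) * x); ring.
  - by exists (y * x); ring.
  - by exists (x * (z - x + y)); ring.
  - by exists (x * (y - x)); ring.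
have dv3 : dv f (\sum_(j < 3) (a`_j)%:~R * der3`_j).
  rewrite f_xyz !big_ord_recl !big_ord0 /=; move: a_shi; rewrite !inE.
  case/or4P=> [|||/or4P[]] /eqP-> /=.
  - by exists 0; ring.
  - by exists ((x - z) * (x - y - z)); ring.
  - by exists (x * (x - y - z)); ring.
  - by exists ((y - z) * (x - y - z)); ring.
  - by exists (y * (x - y - z)); ring.
  - by exists ((x - y - z) * (x + y - z)); ring.
  - by exists ((x - y) * (x + y - z)); ring.
rewrite [X in dv _ X](_ : _ = (nth [::] coef1 k)`_i * f
   + (nth [::] coef2 k)`_i * (\sum_(j < 3) (a`_j)%:~R * der2`_j)
   + (nth [::] coef3 k)`_i * (\sum_(j < 3) (a`_j)%:~R * der3`_j)).
  by apply: dvD; [apply: dvD |]; apply: dvMl.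
rewrite !mulr_sumr -!big_split /=; apply: eq_bigr => j _.
by rewrite /tensor; ring.
Qed.

End Tensors.

(** * Operators attached to matrices in the directions x, y, z *)

Section ShiArrangement.
Local Open Scope ring_scope.
Variables (K : fieldType) (m : nat).
Hypothesis charK0 : [pchar K] =i pred0.
Local Notation S := {mpoly K[m.+3]}.
Local Notation var := (@var m).
Local Notation lform := (@lform K m).
Implicit Types B C : nat -> nat -> S.

(** The sum runs over ordered pairs, so a symmetric [B] is recovered from values on products of two
    variables only up to a factor 2. *)
Definition bilinear (B : nat -> nat -> S) : D2S K m.+3 :=
  \sum_(i < 3) \sum_(j < 3) B i j *: d2mono K (var i) (var j).

Lemma d2op_bilinear B f : d2op (bilinear B) f =
  \sum_(i < 3) \sum_(j < 3) B i j * f^`M(var i)^`M(var j).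
Proof.
rewrite /bilinear d2op_sum; apply: eq_bigr => i _; rewrite d2op_sum.
by apply: eq_bigr => j _; rewrite d2opZ d2op_mono.
Qed.

Lemma bilinear_XX B (i j : 'I_3) :
  d2op (bilinear B) ('X_(var i) * 'X_(var j)) = B i j + B j i.
Proof.
have dX (k l : 'I_3) : ('X_(var l))^`M(var k) = (k == l)%:R :> S.
  by rewrite mderivXU var_inj; case: (_ == _); rewrite ?mpolyC1 ?mpolyC0.
rewrite d2op_bilinear; under eq_bigr => k _ do under eq_bigr => l _ do
  rewrite (affine_mderivM _ _ (@affineX _ _ _) (@affineX _ _ _)) !dX mulrDr.
under eq_bigr => k _ do rewrite big_split.
rewrite big_split /=; congr (_ + _).
  rewrite (bigD1 i) //= [X in _ + X]big1 => [|k ki]; last first.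
    by rewrite big1 // => l _; rewrite (negbTE ki) mul0r mulr0.
  rewrite (bigD1 j) //= big1 => [|l lj]; last by rewrite (negbTE lj) !mulr0.
  by rewrite !eqxx !mulr1 !addr0.
rewrite (bigD1 j) //= [X in _ + X]big1 => [|k kj]; last first.
  by rewrite big1 // => l _; rewrite (negbTE kj) !mulr0.
rewrite (bigD1 i) //= big1 => [|l li]; last by rewrite (negbTE li) mul0r mulr0.
by rewrite !eqxx !mulr1 !addr0.
Qed.

(** Applied to a form times a variable, the operator yields contractions of rows and of columns of
    [B] with the form; symmetry turns columns into rows. *)
Lemma bilinear_D2A (B : nat -> nat -> S) a :
  (forall i j : 'I_3, B i j = B j i) ->
  (forall i : 'I_3, dv (lform a) (\sum_(j < 3) (a`_j)%:~R * B i j)) ->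
  D2A (lform a) (bilinear B).
Proof.
move=> Bsym Ba; apply: d2op_dv => [|k]; first exact: affine_lform.
rewrite d2op_bilinear; under eq_bigr => i _ do under eq_bigr => j _ do
  rewrite (affine_mderivM _ _ (@affine_lform _ _ _) (@affineX _ _ _))
    !mderiv_lform mulrDr.
under eq_bigr => i _ do rewrite big_split.
rewrite big_split /=; apply: dvD.
  rewrite exchange_big /=; elim/big_ind: _ => [||j _]; [exact: dv0|exact: dvD|].
  rewrite [X in dv _ X](_ : _ =
      ('X_k)^`M(var j) * \sum_(i < 3) (a`_i)%:~R * B j i).
    exact: dvMl.
  by rewrite mulr_sumr; apply: eq_bigr => i _; rewrite Bsym; ring.
elim/big_ind: _ => [||i _]; [exact: dv0 | exact: dvD |].
rewrite [X in dv _ X](_ : _ =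
    ('X_k)^`M(var i) * \sum_(j < 3) (a`_j)%:~R * B i j).
  exact: dvMl.
by rewrite mulr_sumr; apply: eq_bigr => j _; ring.
Qed.

Lemma eq_bilinear B C : (forall i j : 'I_3, B i j = C i j) ->
  bilinear B = bilinear C.
Proof.
by move=> BC; apply: eq_bigr => i _; apply: eq_bigr => j _; rewrite BC.
Qed.

Lemma bilinearZ p B : p *: bilinear B = bilinear (fun i j => p * B i j).
Proof.
rewrite scaler_sumr; apply: eq_bigr => i _; rewrite scaler_sumr.
by apply: eq_bigr => j _; rewrite scalerA.
Qed.

Lemma bilinearD B C :
  bilinear B + bilinear C = bilinear (fun i j => B i j + C i j).
Proof.
rewrite -big_split; apply: eq_bigr => i _ /=; rewrite -big_split.
by apply: eq_bigr => j _ /=; rewrite scalerDl.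
Qed.

Local Notation xv k := ('X_(var k) : S).
Local Notation T := (tensor (xv 0) (xv 1) (xv 2)).
Local Notation base := (@point K m [:: 0%N; 0%N; 0%N]).

Lemma xyzE (k : 'I_3) : (xyz (xv 0) (xv 1) (xv 2))`_k = xv k.
Proof. by case: k => [[|[|[|//]]] ?]. Qed.

Local Notation sk := (skew (xv 0) (xv 1) (xv 2)).

Lemma tensor_skewE (k i j : 'I_3) : T k i j - T k j i = xv k * sk i j.
Proof. by have := tensor_skew (xv 0) (xv 1) (xv 2) k i j; rewrite (xyzE k). Qed.

Lemma tensor_rowE a (k i : 'I_3) : a \in shi2 ->
  dv (lform a) (\sum_(j < 3) (a`_j)%:~R * T k i j).
Proof.
move=> a_shi; have := tensor_row (xv 0) (xv 1) (xv 2) k i a_shi.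
by under [X in dv X]eq_bigr => j _ do rewrite xyzE.
Qed.

Lemma lform_base a : (lform a).@[base] = 0.
Proof. by rewrite meval_lform /dot /= !mulr0. Qed.

(** * Quadratic parts at the base point *)

Definition hess (f : S) (k l : 'I_3) : K := f^`M(var k)^`M(var l).@[base].

(** The form vanishes at [base], so only products of its coefficients with the gradient of the
    quotient survive. *)
Lemma hess_dv a f : dv (lform a) f -> exists h : 'I_3 -> K,
  forall k l, hess f k l = (a`_k)%:~R * h l + (a`_l)%:~R * h k.
Proof.
case=> g ->; exists (fun k => g^`M(var k).@[base]) => k l.
rewrite /hess mderivM mderivD !mderivM (@affine_lform _ _ _) !mderiv_lform mul0r.
by rewrite !mevalD !mevalM lform_base !intr_mpolyC !mevalC; ring.
Qed.

Lemma hessB f g k l : hess (f - g) k l = hess f k l - hess g k l.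
Proof. by rewrite /hess !mderivB mevalB. Qed.

Lemma hessMn f n k l : hess (f *+ n) k l = hess f k l *+ n.
Proof. by rewrite /hess !mderivMn mevalMn. Qed.

Lemma hess_lformM f a b k l : hess (f * (lform a * lform b)) k l =
  f.@[base] * ((a`_k)%:~R * (b`_l)%:~R + (a`_l)%:~R * (b`_k)%:~R).
Proof.
rewrite /hess; do 3!rewrite ?(mderivM, mderivD).
rewrite !(@affine_lform _ _ _) !mderiv_lform.
rewrite !(mevalD, mevalM) !lform_base !intr_mpolyC !mevalC.
by ring.
Qed.

Let i0 : 'I_3 := Ordinal (isT : (0 < 3)%N).
Let i1 : 'I_3 := Ordinal (isT : (1 < 3)%N).
Let i2 : 'I_3 := Ordinal (isT : (2 < 3)%N).

Lemma sum3 (V : nmodType) (F : 'I_3 -> V) :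
  \sum_(j < 3) F j = F i0 + F i1 + F i2.
Proof.
rewrite !big_ord_recl big_ord0 addr0 addrA.
by congr (F _ + F _ + F _); apply: val_inj.
Qed.

(* The quadratic parts at [base] behave as for a multiple (l x, l y, l z) of
   the Euler derivation, l linear. *)
Lemma tangent_hess (t : 'I_3 -> S) :
    (forall a, a \in shi2 -> dv (lform a) (\sum_(j < 3) (a`_j)%:~R * t j)) ->
  [/\ hess (t i0) i0 i0 = hess (t i1) i0 i1 *+ 2,
      hess (t i2) i0 i0 = 0 & hess (t i2) i0 i1 = 0].
Proof.
move=> tan.
have rel a : a \in shi2 -> exists h : 'I_3 -> K, forall k l,
    (a`_0)%:~R * hess (t i0) k l + (a`_1)%:~R * hess (t i1) k l
    + (a`_2)%:~R * hess (t i2) k l = (a`_k)%:~R * h l + (a`_l)%:~R * h k.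
  move=> a_shi; have [h hE] := hess_dv (tan a a_shi).
  exists h => k l; rewrite -hE sum3 /hess !intr_mpolyC /=.
  by rewrite !mderivD !mderiv_mulC !mevalD !mevalM !mevalC.
have [//|hz Ez] := rel [:: 0; 0; 1].
have [//|hx Ex] := rel [:: 1; 0; 0].
have [//|hy Ey] := rel [:: 0; 1; 0].
have [//|hxz Exz] := rel [:: 1; 0; -1].
have [//|hyz Eyz] := rel [:: 0; 1; -1].
have [//|hxy Exy] := rel [:: 1; -1; 0].
have [//|hw Ew] := rel [:: 1; -1; -1].
set a := hess (t i0) in Ez Ex Ey Exz Eyz Exy Ew *.
set b := hess (t i1) in Ez Ex Ey Exz Eyz Exy Ew *.
set c := hess (t i2) in Ez Ex Ey Exz Eyz Exy Ew *.
have c00 : c i0 i0 = 0 by have := Ez i0 i0; rewrite /= !mul0r !mul1r !add0r.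
have c01 : c i0 i1 = 0 by have := Ez i0 i1; rewrite /= !mul0r !mul1r !add0r.
have a12 : a i1 i2 = 0.
  by have := Ex i1 i2; rewrite /= !mul0r !mul1r !addr0.
have b02 : b i0 i2 = 0.
  by have := Ey i0 i2; rewrite /= !mul0r !mul1r !addr0 !add0r.
have b00 : b i0 i0 = 0.
  by have := Ey i0 i0; rewrite /= !mul0r !mul1r !addr0 !add0r.
have simp := (mul0r, mul1r, mulrN1z, mulN1r, addr0, add0r, oppr0, mulr1z, mulr0z).
have E1 : a i0 i1 = hxz i1 by have := Exz i0 i1; rewrite /= c01 !simp.
have /oppr_inj E2 : - c i1 i2 = - hxz i1.
  by have := Exz i1 i2; rewrite /= a12 !simp.
have E3 : b i0 i1 = hyz i0 by have := Eyz i0 i1; rewrite /= c01 !simp.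
have /oppr_inj E4 : - c i0 i2 = - hyz i0.
  by have := Eyz i0 i2; rewrite /= b02 !simp.
have E5 : a i0 i2 = hxy i2 by have := Exy i0 i2; rewrite /= b02 !simp.
have /oppr_inj E6 : - b i1 i2 = - hxy i2.
  by have := Exy i1 i2; rewrite /= a12 !simp.
have E7 : a i0 i0 = hw i0 + hw i0.
  by have := Ew i0 i0; rewrite /= b00 c00 !simp.
have E8 : a i0 i2 - c i0 i2 = hw i2 - hw i0.
  by have := Ew i0 i2; rewrite /= b02 !simp.
have E9 : a i0 i1 - b i0 i1 = hw i1 - hw i0.
  by have := Ew i0 i1; rewrite /= c01 !simp.
have E10 : - b i1 i2 - c i1 i2 = - hw i2 - hw i1.
  by have := Ew i1 i2; rewrite /= a12 !simp.
split=> //; rewrite E7.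
(* The relations from x - y - z eliminate [hw i1] and [hw i2]; those from x - z, y - z and x - y
   then identify the remaining entries in pairs. *)
have -> : hw i0 + hw i0 =
   - (- hw i2 - hw i1) - (hw i2 - hw i0) - (hw i1 - hw i0) by ring.
by rewrite -E8 -E9 -E10 E1 E2 E3 E4 E5 E6; ring.
Qed.

(** * Elements of D^(2) and the contradiction with freeness *)

Lemma shi2_coprime_compl a R : a \in shi2 ->
    (forall a b c : nat, (a < 10)%N -> (b < 10)%N -> (c < 2)%N ->
       R.@[@point K m [:: a; b; c]] != 0) ->
  coprime_to (lform a) (\prod_(b <- shi2 | b != a) lform b * R).
Proof.
move=> a_shi Rp; apply: coprime_toM.
  rewrite -big_filter; apply: coprime_to_prod => b; rewrite mem_filter.
  by case/andP=> ba b_shi; apply: lform_coprime2.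
have [p p_test [ap _]] := shi2_points a_shi; apply: (lform_coprime a_shi ap).
have : all (fun p => [&& size p == 3, nth 0%N p 0 < 10, nth 0%N p 1 < 10 &
              nth 0%N p 2 < 2]%N) test_points by [].
move=> /allP/(_ p p_test); case: p {p_test ap} => [|b [|c [|d []]]] //= /and3P[].
exact: Rp.
Qed.

Definition commutator_op (R : S) (k l : nat) : D2S K m.+3 :=
  bilinear (fun i j => R * (xv k * T l i j - xv l * T k i j)).

(** The matrix is symmetric because both terms have the same antisymmetric part, x_k x_l times
    [skew]. *)
Lemma commutator_op_D2A R (k l : 'I_3) :
  D2A ((\prod_(a <- shi2) lform a) * R) (commutator_op R k l).
Proof.
rewrite /commutator_op -bilinearZ; apply: D2A_cofactor.
apply: D2A_prod => // [a b a_shi b_shi ab|a a_shi].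
  by apply: lform_coprime2 => //; rewrite eq_sym.
apply: bilinear_D2A => [i j|i].
  apply/eqP; rewrite -subr_eq0; apply/eqP.
  move: (tensor_skewE l i j) (tensor_skewE k i j).
  move: (T l i j) (T l j i) (T k i j) (T k j i) (sk i j) => u u' v v' s El Ek.
  transitivity (xv k * (u - u') - xv l * (v - v')); first by ring.
  by rewrite El Ek mulrCA subrr.
rewrite [X in dv _ X](_ : _ = xv k * (\sum_(j < 3) (a`_j)%:~R * T l i j)
  - xv l * (\sum_(j < 3) (a`_j)%:~R * T k i j)).
  by apply: dvD; [|apply: dvN]; apply: dvMl; apply: tensor_rowE.
rewrite !mulr_sumr -sumrB; apply: eq_bigr => j _.
by move: (T l i j) (T k i j) => *; ring.
Qed.

Lemma commutator_op_cycle R :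
  xv 2 *: commutator_op R 0 1 =
  xv 0 *: commutator_op R 2 1 + xv 1 *: commutator_op R 0 2.
Proof.
rewrite !bilinearZ bilinearD; apply: eq_bilinear => i j.
by move: (T 0 i j) (T 1 i j) (T 2 i j) => *; ring.
Qed.


Lemma not_two_free_shi2_factor (R : S) :
    (forall a b c : nat, (a < 10)%N -> (b < 10)%N -> (c < 2)%N ->
       R.@[@point K m [:: a; b; c]] != 0) ->
  ~ two_free ((\prod_(a <- shi2) lform a) * R).
Proof.
move=> Rp; set Q := _ * R => freeQ.
have MW k l : (k < 3)%N -> (l < 3)%N -> D2A Q (commutator_op R k l).
  by move=> k3 l3; apply: (commutator_op_D2A R (Ordinal k3) (Ordinal l3)).
have reg := @variables_regular K m.+3 (var 0) (var 1) (var 2) isT isT.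
have [q [p [Mq Mp W01]]] :=
  free_submodule_regular freeQ (D2A0 Q) (@D2AP _ _ Q) reg
  (MW 2 1 isT isT) (MW 0 2 isT isT) (MW 0 1 isT isT) (commutator_op_cycle R).
(* [G th] is twice the symmetric matrix of [th] in the directions x, y, z, whence the doublings
   below. *)
pose G (th : D2S K m.+3) (i j : 'I_3) := d2op th ('X_(var i) * 'X_(var j)).
have Gsym th i j : G th i j = G th j i by rewrite /G mulrC.
pose A0 (i j : 'I_3) := R * T 0 i j *+ 2 + G p i j.
pose A1 (i j : 'I_3) := R * T 1 i j *+ 2 - G q i j.
(* This is [W01] evaluated on a product of two variables; the corrections from transposing [T]
   cancel. *)
have A01 (i j : 'I_3) : xv 1 * A0 i j = xv 0 * A1 i j.
  have := congr1 (fun th => G th i j) W01; rewrite /G bilinear_XX d2opD !d2opZ.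
  have := tensor_skewE i0 i j.
  have := tensor_skewE i1 i j.
  rewrite /A0 /A1 /G; move: (T 0 i j) (T 1 i j) (T 0 j i) (T 1 j i) (sk i j).
  move: (d2op p _) (d2op q _) => gp gq t0 t1 t0' t1' s.
  rewrite -[var i0]/(var 0) -[var i1]/(var 1).
  move=> /eqP; rewrite subr_eq => /eqP-> /eqP; rewrite subr_eq => /eqP->.
  move=> /eqP; rewrite -subr_eq0 => /eqP eW.
  by apply/eqP; rewrite -subr_eq0 -oppr_eq0 -eW; apply/eqP; ring.
have lx : lform [:: 1; 0; 0] = xv 0.
  by rewrite /lform sum3 /= mulr1z !mulr0z mul1r !mul0r !addr0.
have ly : lform [:: 0; 1; 0] = xv 1.
  by rewrite /lform sum3 /= mulr1z !mulr0z mul1r !mul0r addr0 add0r.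
(* As x and y are coprime, x divides [A0]; the common quotient [t] is twice the matrix announced in
   the overview. *)
have ex_t (i : 'I_3) : exists u : 'I_3 -> S, forall j : 'I_3,
    A0 i j = xv 0 * u j /\ A1 i j = xv 1 * u j.
  apply: (@fin_all_exists _ (fun=> S)
    (fun j u => A0 i j = xv 0 * u /\ A1 i j = xv 1 * u)) => j.
  have [u A0u] : dv (xv 0) (A0 i j).
    rewrite -lx; apply: (lform_coprime2 charK0 (b := [:: 0; 1; 0])) => //.
    by exists (A1 i j); rewrite lx ly.
  exists u; split=> //; apply: (mulfI (mpolyXU_neq0 K (var 0))).
  by rewrite -A01 A0u; ring.
have [t tE] := @fin_all_exists _ (fun=> 'I_3 -> S) _ ex_t.
have t_row (i : 'I_3) a : a \in shi2 ->
    dv (lform a) (\sum_(j < 3) (a`_j)%:~R * t i j).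
  move=> a_shi.
  have G_row th : D2A Q th -> dv (lform a) (\sum_(j < 3) (a`_j)%:~R * G th i j).
    move=> Mth; rewrite [X in dv _ X](_ : _ = d2op th (lform a * 'X_(var i))).
      apply: (D2A_dvX (b := \prod_(b <- shi2 | b != a) lform b * R)).
      - exact: affine_lform.
      - exact: shi2_coprime_compl.
      by rewrite mulrA -(bigD1_seq a).
    rewrite mulr_suml linear_sum; apply: eq_bigr => j _ /=.
    by rewrite !intr_mpolyC !mul_mpolyC -scalerAl linearZ /= /G mulrC.
  have x_row : dv (lform a) (xv 0 * (\sum_(j < 3) (a`_j)%:~R * t i j)).
    rewrite [X in dv _ X](_ : _ = R *+ 2 * (\sum_(j < 3) (a`_j)%:~R * T i0 i j)
        + \sum_(j < 3) (a`_j)%:~R * G p i j).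
      by apply: dvD; [apply: dvMl; apply: tensor_rowE | apply: G_row].
    rewrite !mulr_sumr -big_split; apply: eq_bigr => j _ /=.
    rewrite mulrCA -(tE i j).1 /A0.
    by move: (T 0 i j) (G p i j) => *; ring.
  have y_row : dv (lform a) (xv 1 * (\sum_(j < 3) (a`_j)%:~R * t i j)).
    rewrite [X in dv _ X](_ : _ = R *+ 2 * (\sum_(j < 3) (a`_j)%:~R * T i1 i j)
        - \sum_(j < 3) (a`_j)%:~R * G q i j).
      by apply: dvD; [apply: dvMl; apply: tensor_rowE | apply/dvN/G_row].
    rewrite !mulr_sumr -sumrB; apply: eq_bigr => j _ /=.
    rewrite mulrCA -(tE i j).2 /A1.
    by move: (T 1 i j) (G q i j) => *; ring.
  (* Both x and y times the row are divisible by the form; cancel whichever of the two is not the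
     form itself. *)
  have [ax|ax] := eqVneq a [:: 1; 0; 0].
    apply: (lform_coprime2 charK0 (b := [:: 0; 1; 0])); rewrite ?ly //.
    by rewrite ax.
  apply: (lform_coprime2 charK0 (b := [:: 1; 0; 0])); rewrite ?lx //.
  by rewrite eq_sym.
have t_skew (i j : 'I_3) : t i j - t j i = R * sk i j *+ 2.
  apply: (mulfI (mpolyXU_neq0 K (var 0))).
  rewrite mulrBr -(tE i j).1 -(tE j i).1 /A0 Gsym.
  transitivity (R * (T i0 i j - T i0 j i) *+ 2).
    by move: (T 0 i j) (T 0 j i) (G p j i) => *; ring.
  by rewrite tensor_skewE; move: (sk i j) => s; rewrite -[var i0]/(var 0); ring.
(* Comparing entries (2,0) and (0,2) forces twice the xy-coefficient of [t i2 i1] to vanish, while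
   entries (1,2) and (2,1) give it the value -2 R(base). Hence 4 R(base) = 0. *)
have [H20 _ _] := tangent_hess (t_row i2).
have [_ H02 _] := tangent_hess (t_row i0).
have [_ _ H12] := tangent_hess (t_row i1).
have sk20 : sk i2 i0 = 0 by rewrite /skew /= mul0r subrr.
have sk12 : sk i1 i2 = lform [:: 0; 1; -1] * lform [:: 1; -1; -1].
  rewrite /skew /lform !sum3 /= mul1r mul0r subr0 mulr1z !mulr0z !mulrN1z.
  by ring.
have := congr1 (fun f => hess f i0 i0) (t_skew i2 i0).
rewrite sk20 mulr0 mul0rn hessB H02 subr0 H20.
have -> : hess 0 i0 i0 = 0 by rewrite /hess !mderiv0 meval0.
have := congr1 (fun f => hess f i0 i1) (t_skew i1 i2).
rewrite hessB H12 sub0r sk12 hessMn hess_lformM /= => /eqP.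
rewrite eqr_oppLR => /eqP->.
rewrite mulr0z mulr1z !mulrN1z mul0r add0r mulr1 mulr1 => /eqP.
rewrite -mulNrn -mulrnA -mulr_natr mulf_eq0 oppr_eq0.
by rewrite (negbTE (Rp 0 0 0 isT isT isT)) /= ((pcharf0P K).1 charK0).
Qed.

End ShiArrangement.

Theorem theorem1p8 (K : fieldType) (charK0 : [pchar K]%R =i pred0)
  (l : nat) (l_ge2 : 2 <= l) : ~ two_free (ShiQ K l).
Proof.
case: l l_ge2 => [|[|m]] // _; have [R [-> Rp]] := ShiQ_factor m charK0.
exact: not_two_free_shi2_factor.
Qed.
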